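(* Let $\alpha\in[0,1]$. Let $G_1$ be a $t_1$-regular graph of order $n_1$ and size $m_1$, and let $G_2$ be an arbitrary graph of order $n_2$. Then $$\begin{aligned}\phi_{A_{\alpha}(G_1 \underline{\vee}_T G_2)}(\nu) &=(\nu +2 -2\alpha -2\alpha t_1 -\alpha n_2)^{m_1 -n_1}\, \phi_{A_{\alpha}(G_2)}(\nu- \alpha m_1)\\ &\quad\times \prod_{i=2}^{n_1}\Big(\nu^2 +\big(2-t_1-2\alpha -\alpha t_1 -\alpha n_2 -2\lambda_i(A_\alpha(G_1))\big)\nu -t_1(1-\alpha)(1-3\alpha)\\ &\qquad\qquad +\big(\alpha t_1 + \lambda_i(A_{\alpha}(G_1))\big)\big(t_1 -3+3\alpha + \alpha n_2 + \lambda_i(A_{\alpha}(G_1))\big) \Big)\\ &\quad\times \Big( (\nu-t_1-\alpha t_1)(\nu+2-2\alpha -2t_1-\alpha n_2) -2t_1(1-\alpha)^2 -\tfrac{1}{2}t_1 n_1(1-\alpha)^2(\nu-t_1-\alpha t_1)\, \Upsilon_{A_{\alpha}(G_2)}(\nu-\alpha m_1) \Big).\end{aligned}$$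
   Context: All graphs are finite, undirected and simple. For a graph $G$ with adjacency matrix $A(G)$ and diagonal degree matrix $D(G)$, put $A_\alpha(G)=\alpha D(G)+(1-\alpha)A(G)$. For an $n\times n$ matrix $M$, $\phi_M(\nu)=\det(\nu I_n-M)$, and for symmetric $M$ the eigenvalues are listed with multiplicity as $\lambda_1(M)\ge\lambda_2(M)\ge\cdots\ge\lambda_n(M)$. The $M$-coronal is the rational function $\Upsilon_M(\nu)=\mathbf 1_n^T(\nu I_n-M)^{-1}\mathbf 1_n$, where $\mathbf 1_n$ is the all-ones column vector. The identity is an identity of rational functions in $\nu$. The total graph $T(G)$ is obtained from $G$ (keeping all its vertices and edges) by adding one new vertex for every edge of $G$, making each new vertex adjacent to the two end vertices of the corresponding edge, and making two new vertices adjacent whenever their corresponding (distinct) edges share an endpoint in $G$. The $T$-edge join $G_1\underline\vee_T G_2$ is obtained from the disjoint union of $T(G_1)$ and $G_2$ by joining each newly added vertex of $T(G_1)$ to every vertex of $G_2$. *)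

(* Defs.v *)
From HB Require Import structures.
From mathcomp Require Import all_boot all_order all_algebra.
From mathcomp Require Import fraction polyrcf.
From mathcomp Require Import reals.

Set Implicit Arguments.
Unset Strict Implicit.
Unset Printing Implicit Defensive.

Import Order.TTheory GRing.Theory Num.Theory.
Local Open Scope ring_scope.

Record sgraph := SGraph {
  vertex :> finType;
  adj : rel vertex;
  adj_sym : symmetric adj;
  adj_irr : irreflexive adj }.

Section Graphs.
Implicit Types G : sgraph.

Definition gorder G : nat := #|G|.

Definition deg G (v : G) : nat := #|[set w | adj v w]|.

Definition regular G (t : nat) : Prop := forall v : G, deg v = t.

Definition edge_set G : {set {set G}} :=
  [set [set p.1; p.2] | p : G * G & adj p.1 p.2].

Definition gsize G : nat := #|edge_set G|.

Definition edge G : finType := {x : {set G} | x \in edge_set G}.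

(* [inl] is an original vertex, [inr] the new vertex attached to an edge. *)
Definition total_adj G : rel (G + edge G) := fun x y =>
  match x, y with
  | inl u, inl v => adj u v
  | inl u, inr f => u \in val f
  | inr f, inl v => v \in val f
  | inr f, inr g => (f != g) && (val f :&: val g != set0)
  end.

Lemma total_adj_sym G : symmetric (@total_adj G).
Proof.
case=> [u|f] [v|g] //=; first exact: adj_sym.
by rewrite eq_sym setIC.
Qed.

Lemma total_adj_irr G : irreflexive (@total_adj G).
Proof. by case=> [u|f] /=; rewrite ?adj_irr ?eqxx. Qed.

Definition total_graph G : sgraph :=
  SGraph (@total_adj_sym G) (@total_adj_irr G).

Definition is_new G (x : total_graph G) : bool :=
  if x is inr _ then true else false.

Definition T_edge_join_adj G1 G2 : rel (total_graph G1 + G2) := fun x y =>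
  match x, y with
  | inl u, inl v => adj u v
  | inr u, inr v => adj u v
  | inl u, inr _ => is_new u
  | inr _, inl v => is_new v
  end.

Lemma T_edge_join_adj_sym G1 G2 : symmetric (@T_edge_join_adj G1 G2).
Proof. by move=> [u|u] [v|v] //=; [exact: total_adj_sym | exact: adj_sym]. Qed.

Lemma T_edge_join_adj_irr G1 G2 : irreflexive (@T_edge_join_adj G1 G2).
Proof. by case=> u; [exact: total_adj_irr | exact: adj_irr]. Qed.

Definition T_edge_join G1 G2 : sgraph :=
  SGraph (@T_edge_join_adj_sym G1 G2) (@T_edge_join_adj_irr G1 G2).

End Graphs.

Section Matrices.
Variable R : realType.

(* Rows and columns are indexed by the canonical enumeration of the vertices. *)
Definition adj_mx (G : sgraph) : 'M[R]_(gorder G) :=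
  \matrix_(i, j) (adj (enum_val i : G) (enum_val j : G))%:R.

Definition deg_mx (G : sgraph) : 'M[R]_(gorder G) :=
  diag_mx (\row_i (deg (enum_val i : G))%:R).

Definition A_alpha (alpha : R) (G : sgraph) : 'M[R]_(gorder G) :=
  alpha *: deg_mx G + (1 - alpha) *: adj_mx G.

(* The real eigenvalues of M in nonincreasing order, each repeated according
   to its multiplicity as a root of the characteristic polynomial. *)
Definition eigenvalues n (M : 'M[R]_n) : seq R :=
  sort >=%R
    (flatten [seq nseq (mup x (char_poly M)) x | x <- rootsR (char_poly M)]).

(* Indices start at 1, as in lambda_1 >= ... >= lambda_n. *)
Definition lambda n (M : 'M[R]_n) (i : nat) : R := nth 0 (eigenvalues M) i.-1.

(* The field R(nu) of rational functions; the variable nu is 'X. *)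
Definition ratfun := {fraction {poly R}}.

Definition polyF (p : {poly R}) : ratfun := tofrac p.

Definition constF (c : R) : ratfun := polyF c%:P.

Definition nu : ratfun := polyF 'X.

(* The characteristic polynomial and the coronal take as argument the rational
   function substituted for the variable, so phi M nu is phi_M(nu) itself. *)
Definition phi n (M : 'M[R]_n) (x : ratfun) : ratfun :=
  \det (x%:M - map_mx constF M).

Lemma phi_char_poly n (M : 'M[R]_n) : phi M nu = polyF (char_poly M).
Proof.
rewrite /phi /polyF /char_poly -det_map_mx; congr (\det _).
by apply/matrixP=> i j; rewrite !mxE rmorphB rmorphMn.
Qed.

Definition coronal n (M : 'M[R]_n) (x : ratfun) : ratfun :=
  ((const_mx 1 : 'cV_n)^T *m invmx (x%:M - map_mx constF M)
     *m (const_mx 1 : 'cV_n)) 0 0.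

End Matrices.

Arguments nu {R}.
Notation "c %:K" := (constF c) (at level 2, left associativity, format "c %:K")
  : ring_scope.

(* Main.v *)
(* The vertices of the join split as V(G1), E(G1), V(G2). Eliminating the G2
   block by a Schur complement replaces it by c^2 Upsilon J added to the edge
   block, with c = 1 - alpha. Writing B for the incidence matrix of G1, one has
   B B^T = A + t I, B^T B = A(line graph) + 2 I and J = B^T J B / 4, so the edge
   block is y - B^T X B with y the base of the power in the theorem. A second
   Schur complement and Sylvester's identity
   det(y - V U) = y^(m-n) det(y - U V) bring everything to V(G1), where the
   matrix is a quadratic polynomial in A minus a multiple of J. Diagonalizing
   A_alpha(G1) over R factors it; the all-ones vector, which carries the
   correction by J, belongs to lambda_1 = t by the Gershgorin bound. *)

Require Import Defs.
From HB Require Import structures.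
From mathcomp Require Import all_boot all_order all_algebra.
From mathcomp Require Import perm fraction polyrcf complex.
From mathcomp Require Import reals.
From mathcomp Require Import ring.

Set Implicit Arguments.
Unset Strict Implicit.
Unset Printing Implicit Defensive.

Import Order.TTheory GRing.Theory Num.Theory.
Local Open Scope ring_scope.

(** * Schur complements and the determinant of the vertex-edge block *)

Section Determinants.
Variable F : fieldType.

Lemma det_schur_dr n m (A : 'M[F]_n) (B : 'M_(n, m)) (C : 'M_(m, n)) (D : 'M_m) :
  D \in unitmx ->
  \det (block_mx A B C D) = \det D * \det (A - B *m invmx D *m C).
Proof.
move=> uD; have -> : block_mx A B C D =
    block_mx 1%:M (B *m invmx D) 0 1%:M
    *m block_mx (A - B *m invmx D *m C) 0 C D.
  rewrite mulmx_block !mul1mx !mul0mx !add0r subrK.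
  by rewrite -[_ *m _ *m D]mulmxA mulVmx // mulmx1.
by rewrite det_mulmx det_ublock det_lblock !det1 !mul1r mulrC.
Qed.

Lemma det_schur_ul n m (A : 'M[F]_n) (B : 'M_(n, m)) (C : 'M_(m, n)) (D : 'M_m) :
  A \in unitmx ->
  \det (block_mx A B C D) = \det A * \det (D - C *m invmx A *m B).
Proof.
move=> uA; have -> : block_mx A B C D =
    block_mx 1%:M 0 (C *m invmx A) 1%:M
    *m block_mx A B 0 (D - C *m invmx A *m B).
  rewrite mulmx_block !mul1mx !mul0mx !addr0.
  by rewrite -[_ *m _ *m A]mulmxA mulVmx // mulmx1 addrC subrK.
by rewrite det_mulmx det_ublock det_lblock !det1 !mul1r.
Qed.

(** Take both Schur complements of the block matrix with rows (1, U) and (V, y). The exponent is an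
    integer because [m] may be smaller than [n], whence [y != 0]. *)
Lemma det_scalar_sub_mulmxC n m (y : F) (U : 'M_(n, m)) (V : 'M_(m, n)) :
  y != 0 ->
  \det (y%:M - V *m U) = y ^ (m%:Z - n%:Z) * \det (y%:M - U *m V).
Proof.
move=> y0.
have uy k : (y%:M : 'M[F]_k) \in unitmx.
  by rewrite unitmxE det_scalar unitfE expf_neq0.
have := det_schur_ul U V y%:M (unitmx1 F n).
rewrite det_schur_dr // invmx1 mulmx1 det1 mul1r => <-.
rewrite invmx_scalar mul_mx_scalar -scalemxAl det_scalar.
have -> : y%:M - U *m V = y *: (1%:M - y^-1 *: (U *m V)).
  by rewrite scalerBr scalerA divff // scale1r scalemx1.
rewrite detZ mulrA expfzDr // -exprnN -exprnP.
by rewrite mulfVK // expf_neq0.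
Qed.

Lemma det_1_sub_ones n (s : F) :
  \det (1%:M - s *: const_mx 1 : 'M_n) = 1 - s * n%:R.
Proof.
have -> : s *: const_mx 1 =
    (s *: const_mx 1 : 'cV_n) *m (const_mx 1 : 'rV_n).
  by apply/matrixP=> i j; rewrite !mxE big_ord1 !mxE !mulr1.
rewrite (@det_scalar_sub_mulmxC 1) ?oner_neq0 // exp1rz mul1r det_mx11 !mxE.
by under eq_bigr do rewrite !mxE mulr1 mul1r; rewrite sumr_const card_ord mulr_natr.
Qed.

Lemma mul_const1_mx n m (a b : F) :
  (const_mx a : 'M_(n, 1)) *m (const_mx b : 'M_(1, m)) = const_mx (a * b).
Proof. by apply/matrixP=> i j; rewrite !mxE big_ord1 !mxE. Qed.

(** In use, [A] and [B] are the adjacency and incidence matrices of a [t]-regular graph, [c] is 1 -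
    alpha, and [g] is [c ^+ 2] times the coronal of G2. *)
Variables (n m : nat) (A : 'M[F]_n) (B : 'M[F]_(n, m)).
Variables (x y c g t : F).
Hypothesis y0 : y != 0.
Hypothesis two0 : (2 : F) != 0.
Hypothesis uP : x%:M - c *: A \in unitmx.
Hypothesis BBT : B *m B^T = A + t%:M.
Hypothesis rowA : A *m (const_mx 1 : 'cV_n) = t *: const_mx 1.
Hypothesis symA : A^T = A.
Hypothesis colB : B^T *m (const_mx 1 : 'cV_n) = const_mx 2.

Let J : 'M[F]_n := const_mx 1.

Lemma mulmx_A_ones : A *m J = t *: J.
Proof.
have -> : J = (const_mx 1 : 'cV_n) *m (const_mx 1 : 'rV_n).
  by rewrite mul_const1_mx mulr1.
by rewrite mulmxA rowA -scalemxAl.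
Qed.

Lemma mulmx_ones_A : J *m A = t *: J.
Proof.
rewrite -[LHS]trmxK trmx_mul symA trmx_const mulmx_A_ones.
by rewrite linearZ /= trmx_const.
Qed.

(* The all-ones block is [1/4 B^T J B] since every column of [B] sums to 2, so
   the lower right Schur complement has the form [y - B^T X B]. *)
Lemma det_total_blocks :
  \det (block_mx (x%:M - c *: A) (- (c *: B)) (- (c *: B^T))
          (y%:M - c *: (B^T *m B) - g *: const_mx 1)) =
  y ^ (m%:Z - n%:Z) *
  \det (y *: (x%:M - c *: A)
        - (x%:M - c *: A + c%:M) *m (c *: A + (c * t)%:M)
        - (g / 2 * (x - c * t) * t) *: J).
Proof.
set P := x%:M - c *: A; have uP' : P \in unitmx := uP.
have four0 : (4 : F) != 0 by rewrite (natrM _ 2 2) mulf_neq0.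
have JE : const_mx 1 = 4^-1 *: (B^T *m J *m B).
  have -> : J = (const_mx 1 : 'cV_n) *m (const_mx 1 : 'rV_n).
    by rewrite mul_const1_mx mulr1.
  rewrite !mulmxA colB -mulmxA.
  have -> : (const_mx 1 : 'rV_n) *m B = const_mx 2.
    by rewrite -[LHS]trmxK trmx_mul trmx_const colB trmx_const.
  rewrite mul_const1_mx; apply/matrixP=> i j; rewrite !mxE.
  by field.
(* The matrix X announced above: its terms come from [B^T *m B], from the all-ones block and from
   the Schur complement of [P], in this order. *)
pose K := c%:M + (g / 4) *: J + c ^+ 2 *: invmx P.
rewrite det_schur_ul //.
have -> : y%:M - c *: (B^T *m B) - g *: const_mx 1
          - - (c *: B^T) *m invmx P *m - (c *: B) = y%:M - B^T *m (K *m B).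
  rewrite JE /K !mulmxDl !mulmxDr mul_scalar_mx -!scalemxAl -!scalemxAr.
  rewrite !mulNmx !mulmxN -!scalemxAl -!scalemxAr scalerA !mulmxA.
  rewrite expr2 scalerA opprK.
  by rewrite !opprD !addrA.
(* Once the swap has moved the determinant to the vertex side, absorbing [\det P] clears the inverse
   of [P] inside [K]. *)
rewrite det_scalar_sub_mulmxC // mulrCA -det_mulmx; congr (_ * \det _).
rewrite mulmxBr mul_mx_scalar -mulmxA BBT mulmxA -addrA -opprD; congr (_ - _).
have -> : P *m K = c *: (P + c%:M) + (g / 4 * (x - c * t)) *: J.
  rewrite /K !mulmxDr mul_mx_scalar -!scalemxAr mulmxV //.
  rewrite {2}/P mulmxBl mul_scalar_mx -scalemxAl mulmx_A_ones.
  rewrite scalerA -scalerBl scalerA scalemx1.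
  by rewrite addrAC expr2 !scalerDr !scale_scalar_mx.
rewrite mulmxDl -scalemxAl -scalemxAl; congr (_ + _).
  by rewrite scalemxAr scalerDr scale_scalar_mx.
rewrite mulmxDr mulmx_ones_A mul_mx_scalar -scalerDl scalerA.
congr (_ *: _); field.
by rewrite two0.
Qed.

End Determinants.

(** * Quadratic polynomial in a diagonalizable matrix, corrected by all-ones *)

Section DiagonalizedQuadratic.
Variable F : fieldType.

(* Valid for a multiple eigenvalue [t] too: [q(C) - e J = q(C) (1 - e/q(t) J)]
   only uses that the all-ones vector is an eigenvector. *)
Lemma det_quadratic_sub_ones n (C P : 'M[F]_n) (d : 'rV_n) (b k e t : F) :
  P \in unitmx -> C = invmx P *m diag_mx d *m P ->
  C *m const_mx 1 = t *: (const_mx 1 : 'M_n) ->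
  t ^+ 2 + b * t + k != 0 ->
  \det (C *m C + b *: C + k%:M - e *: const_mx 1) =
  (\prod_i (d 0 i ^+ 2 + b * d 0 i + k)) * (1 - e / (t ^+ 2 + b * t + k) * n%:R).
Proof.
move=> uP CE C1 q0; set q := t ^+ 2 + b * t + k in q0 *.
have -> : C *m C + b *: C + k%:M - e *: const_mx 1 =
    (C *m C + b *: C + k%:M) *m (1%:M - (e / q) *: const_mx 1).
  rewrite mulmxBr mulmx1; congr (_ - _).
  rewrite -scalemxAr !mulmxDl -mulmxA C1 -scalemxAr -scalemxAl C1.
  rewrite mul_scalar_mx !scalerA -!scalerDl scalerA; congr (_ *: _).
  by rewrite -expr2 -/q mulfVK.
rewrite det_mulmx det_1_sub_ones; congr (_ * _).
have -> : C *m C + b *: C + k%:M =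
    invmx P *m diag_mx (\row_i (d 0 i ^+ 2 + b * d 0 i + k)) *m P.
  have -> : diag_mx (\row_i (d 0 i ^+ 2 + b * d 0 i + k)) =
      diag_mx d *m diag_mx d + b *: diag_mx d + k%:M.
    rewrite mulmx_diag; apply/matrixP=> i j; rewrite !mxE.
    by case: eqP => [->|_]; rewrite ?mulr1n ?mulr0n ?mulr0 ?addr0 // expr2.
  rewrite !mulmxDr !mulmxDl -scalemxAr -scalemxAl -CE.
  rewrite mul_mx_scalar -scalemxAl mulVmx // scalemx1; congr (_ + _ + _).
  by rewrite {1 2}CE !mulmxA mulmxK.
rewrite !det_mulmx det_inv det_diag mulrAC mulVf ?mul1r -?unitfE -?unitmxE //.
by apply: eq_bigr => i _; rewrite mxE.
Qed.

End DiagonalizedQuadratic.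

(** * Real spectrum of symmetric matrices and the largest eigenvalue *)

Section Eigenvalues.
Variable R : realType.

(** The complex spectral theorem gives a diagonal form with real entries. The minimal polynomial
    thus divides a product of distinct real linear factors, and this divisibility descends to
    [R]. *)
Lemma symmetric_diagonalizable n (S : 'M[R]_n) : S^T = S ->
  exists P d, P \in unitmx /\ S = invmx P *m diag_mx d *m P.
Proof.
(* Order 0 is treated apart: minimal polynomials are defined for positive order. *)
case: n S => [|n] S symS.
  by exists 1%:M, 0; split; [exact: unitmx1 | apply/matrixP => -[]].
pose toC := real_complex R.
have hS : map_mx toC S \is hermsymmx.
  apply: realsym_hermsym.
    apply/is_hermitianmxP; rewrite expr0 scale1r.
    by rewrite map_mx_id // map_trmx symS.
  by apply/mxOverP=> i j; rewrite mxE complex_real eqxx.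
have /hermitian_normalmx/orthomx_spectralP SE := hS.
have dreal := hermitian_spectral_diag_real hS.
set d := spectral_diag _ in SE dreal.
have dE i : toC (complex.Re (d 0 i)) = d 0 i.
  by rewrite /toC RRe_real //; move/mxOverP: dreal; apply.
have : diagonalizable S.
  apply/diagonalizableP.
  (* Repetitions are removed because the criterion asks for distinct roots. *)
  exists (undup [seq complex.Re (d 0 i) | i <- enum 'I_n.+1]); first exact: undup_uniq.
  rewrite -(dvdp_map toC) -mxminpoly_map SE -conjVmx ?spectral_unit //.
  rewrite mxminpoly_uconj ?unitmx_inv ?spectral_unit // mxminpoly_diag.
  rewrite rmorph_prod; under [X in _ %| X]eq_bigr do rewrite /= map_polyXsubC.
  rewrite -(big_map toC predT (fun x => 'X - x%:P)) -undup_map_inj; last first.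
    exact: complexI.
  have dM : map toC [seq complex.Re (d 0 i) | i <- enum 'I_n.+1] =
      [seq d 0 i | i <- enum 'I_n.+1].
    by rewrite -map_comp; apply: eq_map; exact: dE.
  by rewrite dM.
case=> P uP /(diagonalizable_forLR uP)[e ->].
exists P, e; split => //.
by rewrite mxpoly.conjVmx.
Qed.

Lemma char_poly_diagonalized n (S P : 'M[R]_n) (d : 'rV_n) :
  P \in unitmx -> S = invmx P *m diag_mx d *m P ->
  char_poly S = \prod_(x <- [seq d 0 i | i <- enum 'I_n]) ('X - x%:P).
Proof.
move=> uP ->; pose Q := map_mx polyC P.
have uQ : Q \in unitmx.
  by rewrite unitmxE det_map_mx rmorph_unit // -unitmxE.
rewrite /char_poly.
have -> : char_poly_mx (invmx P *m diag_mx d *m P) =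
    map_mx polyC (invmx P) *m char_poly_mx (diag_mx d) *m Q.
  rewrite /char_poly_mx mulmxBr mulmxBl -!map_mxM mul_mx_scalar -scalemxAl.
  by rewrite -map_mxM mulVmx // map_scalar_mx scalemx1.
rewrite !det_mulmx mulrAC -det_mulmx -map_mxM mulVmx // map_mx1 det1 mul1r.
have := @char_poly_trig _ _ (diag_mx d) (diag_mx_is_trig d).
rewrite /char_poly => ->; rewrite big_map big_enum.
by apply: eq_bigr => i _; rewrite mxE eqxx mulr1n.
Qed.

(** Both lists contain each [x] as often as its multiplicity as a root of the characteristic
    polynomial, which splits over the diagonal. *)
Lemma perm_eigenvalues n (S P : 'M[R]_n) (d : 'rV_n) :
  P \in unitmx -> S = invmx P *m diag_mx d *m P ->
  perm_eq (eigenvalues S) [seq d 0 i | i <- enum 'I_n].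
Proof.
move=> uP SE; rewrite perm_sort; apply/allP=> x _ /=; apply/eqP.
have S0 : char_poly S != 0 by rewrite monic_neq0 // char_poly_monic.
rewrite -[RHS]mu_prod_XsubC -(char_poly_diagonalized uP SE).
rewrite count_flatten -map_comp.
have -> : sumn [seq (count_mem x \o fun y => nseq (mup y (char_poly S)) y) i
                 | i <- rootsR (char_poly S)] =
   ((x \in rootsR (char_poly S)) * mup x (char_poly S))%N.
  elim: (rootsR _) (uniq_roots _ _ _ : uniq (rootsR (char_poly S))) => //= y s IH.
  case/andP=> ys /IH->; rewrite count_nseq in_cons /= eq_sym.
  by case: eqVneq => [->|_]; rewrite ?(negPf ys) ?mul1n ?mul0n ?addn0 ?add0n.
have /(_ x) := roots_on_rootsR S0.
rewrite inE /= => <-; case: (boolP (root _ _)) => [_|nr]; first by rewrite mul1n.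
by rewrite mupNroot.
Qed.

Lemma mem_eigenvalues n (S : 'M[R]_n) x :
  x \in eigenvalues S = root (char_poly S) x.
Proof.
have S0 : char_poly S != 0 by rewrite monic_neq0 // char_poly_monic.
have rE y : (y \in rootsR (char_poly S)) = root (char_poly S) y.
  by have /(_ y) := roots_on_rootsR S0; rewrite inE /= => <-.
rewrite mem_sort; apply/flatten_mapP/idP => [[y]|rx].
  by rewrite rE mem_nseq => ry /andP[_ /eqP->].
exists x; rewrite ?rE // mem_nseq eqxx andbT.
by rewrite -XsubC_dvd // dvdp_XsubCl.
Qed.

(* Gershgorin: at an entry of maximal modulus of an eigenvector. *)
Lemma eigenvalue_le_row_sum n (S : 'M[R]_n) (t x : R) :
  (forall i j, 0 <= S i j) -> (forall j, \sum_i S i j = t) ->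
  root (char_poly S) x -> x <= t.
Proof.
move=> S0 St; rewrite -eigenvalue_root_char => /eigenvalueP[v vS v0].
have [k vk] : exists k, v 0 k != 0.
  apply/existsP; apply: contraNT v0; rewrite negb_exists => /forallP v0.
  by apply/eqP/rowP=> i; rewrite mxE; apply/eqP; have := v0 i; rewrite negbK.
pose i := [arg max_(i > k) `|v 0 i|]%O.
have vmax j : `|v 0 j| <= `|v 0 i|.
  by rewrite /i; case: arg_maxP => // i' _; apply.
have vi0 : 0 < `|v 0 i| by apply: lt_le_trans (vmax k); rewrite normr_gt0.
rewrite -(ler_pM2r vi0); apply: le_trans (_ : `|x * v 0 i| <= _).
  by rewrite normrM ler_wpM2r // ler_norm.
have /rowP/(_ i) := vS; rewrite !mxE => <-.
apply: le_trans (ler_norm_sum _ _ _) _.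
rewrite -(St i) mulr_suml; apply: ler_sum => j _.
by rewrite normrM mulrC (ger0_norm (S0 _ _)) ler_wpM2l.
Qed.

Lemma size_eigenvalues n (S : 'M[R]_n) : S^T = S -> size (eigenvalues S) = n.
Proof.
move=> /symmetric_diagonalizable[P [d [uP SE]]].
by rewrite (perm_size (perm_eigenvalues uP SE)) size_map size_enum_ord.
Qed.

(** Gershgorin gives the upper bound. Conversely the all-ones row is a left eigenvector for [t], so
    [t] occurs in the nonincreasing list and is at most its head. *)
Lemma lambda1_row_sum n (S : 'M[R]_n) (t : R) : (0 < n)%N ->
  S^T = S -> (forall i j, 0 <= S i j) -> (forall j, \sum_i S i j = t) ->
  lambda S 1 = t.
Proof.
move=> n0 symS S0 St; apply/eqP; rewrite eq_le; apply/andP; split.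
  apply: (eigenvalue_le_row_sum S0 St).
  (* Positive order ensures that [lambda S 1] is a genuine entry and not the default 0. *)
  by rewrite -mem_eigenvalues mem_nth // size_eigenvalues.
have: t \in eigenvalues S.
  rewrite mem_eigenvalues -eigenvalue_root_char; apply/eigenvalueP.
  exists (const_mx 1).
    apply/rowP=> j; rewrite !mxE mulr1 -(St j).
    by apply: eq_bigr => i _; rewrite mxE mul1r.
  apply: contraTneq (oner_neq0 R) => /rowP/(_ (Ordinal n0)).
  by rewrite !mxE => ->; rewrite eqxx.
case/(nthP 0) => k klt <-; rewrite /lambda.
have ge_trans : transitive (>=%R : rel R) by move=> a b e ab /le_trans; apply.
have := sorted_leq_nth ge_trans (@lexx _ R) 0 (sort_sorted (@ge_total _ R) _).
by apply; rewrite ?inE //; apply: leq_ltn_trans klt.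
Qed.

End Eigenvalues.

(** * From the canonical vertex enumeration to block order *)

Section Reindexing.

(** Lists the left summand first, so that matrices indexed through it split as [block_mx]. *)
Definition sum_index (p q : nat) (T U : Type) (f : 'I_p -> T) (g : 'I_q -> U)
    (i : 'I_(p + q)) : T + U :=
  match split i with inl j => inl (f j) | inr k => inr (g k) end.

Lemma sum_index_inj (p q : nat) (T U : Type) (f : 'I_p -> T) (g : 'I_q -> U) :
  injective f -> injective g -> injective (sum_index f g).
Proof.
move=> fI gI i j; rewrite /sum_index -{2}(splitK i) -{2}(splitK j).
by case: (split i) (split j) => k [l|l] // [] => [/fI|/gI] ->.
Qed.

Lemma matrix_sum_index (K : Type) (p q : nat) (T U : Type)
    (f : 'I_p -> T) (g : 'I_q -> U) (e : T + U -> T + U -> K) :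
  \matrix_(i, j) e (sum_index f g i) (sum_index f g j) =
  block_mx (\matrix_(i, j) e (inl (f i)) (inl (f j)))
           (\matrix_(i, j) e (inl (f i)) (inr (g j)))
           (\matrix_(i, j) e (inr (g i)) (inl (f j)))
           (\matrix_(i, j) e (inr (g i)) (inr (g j))).
Proof.
apply/matrixP=> i j; rewrite mxE /sum_index -{2}(splitK i) -{2}(splitK j).
by case: (split i) (split j) => k [l|l] /=;
  rewrite ?block_mxEul ?block_mxEur ?block_mxEdl ?block_mxEdr mxE.
Qed.

(** Rows and columns undergo the same permutation, whose sign occurs twice. The size [k] is kept
    apart from [#|T|] since block sizes are sums only provably equal to it. *)
Lemma det_reindex (K : comNzRingType) (T : finType) (k : nat) (h : 'I_k -> T)
    (e : T -> T -> K) : injective h -> k = #|T| ->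
  \det (\matrix_(i < #|T|, j < #|T|) e (enum_val i) (enum_val j)) =
  \det (\matrix_(i, j) e (h i) (h j)).
Proof.
move=> hI kE; subst k.
have sI : injective (enum_rank \o h) by move=> i j /enum_rank_inj/hI.
pose s := perm sI.
have -> : \matrix_(i, j) e (h i) (h j) =
    row_perm s (col_perm s (\matrix_(i < #|T|, j < #|T|) e (enum_val i) (enum_val j))).
  by apply/matrixP=> i j; rewrite !mxE !permE /= !enum_rankK.
rewrite row_permE col_permE !det_mulmx mulrCA !det_perm odd_permV.
by rewrite -signr_addb addbb mulr1.
Qed.

End Reindexing.

(** * Counting incidences of vertices and edges *)

Section Incidence.
Variable G : sgraph.

Lemma deg_sum (v : G) : deg v = (\sum_w adj v w)%N.
Proof. by rewrite /deg -sum1dep_card big_mkcond; apply: eq_bigr => w _; case: adj. Qed.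

Lemma edge_setP (u v : G) : ([set u; v] \in edge_set G) = adj u v.
Proof.
apply/imsetP/idP => [[[p q]]|uv]; last first.
  by exists (u, v); rewrite ?inE.
rewrite inE /= => pq E.
have p_ne_q : p != q by apply: contraTneq pq => ->; rewrite adj_irr.
have : p \in [set u; v] by rewrite E !inE eqxx.
have : q \in [set u; v] by rewrite E !inE eqxx orbT.
rewrite !inE => /orP[]/eqP qE /orP[]/eqP pE; subst p q => //.
- by rewrite eqxx in p_ne_q.
- by rewrite adj_sym.
- by rewrite eqxx in p_ne_q.
Qed.

Lemma card_edge (e : edge G) : #|val e| = 2.
Proof.
case: e => e /= /imsetP[[u v]]; rewrite inE /= => uv ->.
by rewrite cards2; case: eqVneq uv => // ->; rewrite adj_irr.
Qed.

Lemma sum_mem_edge (e : edge G) : (\sum_u (u \in val e) = 2)%N.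
Proof.
rewrite -[RHS](card_edge e) -sum1_card [RHS]big_mkcond.
by apply: eq_bigr => u _; case: (_ \in _).
Qed.

(** An edge has two elements, so one containing both [u] and [v] is [[set u; v]]: at most one term
    survives. *)
Lemma sum_edges_two (u v : G) : u != v ->
  (\sum_(e : edge G) (u \in val e) * (v \in val e) = adj u v)%N.
Proof.
move=> uv.
have memE (e : edge G) : (u \in val e) && (v \in val e) = (val e == [set u; v]).
  apply/andP/eqP => [[ue ve]|->]; last by rewrite !inE !eqxx orbT.
  apply/esym/eqP; rewrite eqEcard card_edge cards2 uv andbT.
  by apply/subsetP=> w; rewrite !inE => /orP[]/eqP->.
under eq_bigr do rewrite mulnb memE.
rewrite -edge_setP; case: (boolP (_ \in _)) => [uvE|nuv].
  pose e0 : edge G := exist (fun x => x \in edge_set G) _ uvE.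
  rewrite (bigD1 e0) //= eqxx big1 // => e.
  by rewrite -val_eqE /= => /negPf->.
rewrite big1 // => e _; case: eqP => // eE.
by case/negP: nuv; rewrite -eE; exact: (valP e).
Qed.

(** Count pairs (e, w) with [u] and [w] in [e]. Each edge at [u] counts twice; the terms with w = u
    give one copy of the sum, the others the neighbours of [u]. *)
Lemma sum_edges_at (u : G) : (\sum_(e : edge G) (u \in val e) = deg u)%N.
Proof.
apply/eqP; rewrite -(eqn_add2l (\sum_(e : edge G) (u \in val e))) {1}addnn -muln2.
rewrite big_distrl /=; apply/eqP.
transitivity (\sum_(e : edge G) \sum_w (u \in val e) * (w \in val e))%N.
  by apply: eq_bigr => e _; rewrite -big_distrr /= sum_mem_edge.
rewrite exchange_big /= (bigD1 u) //=; congr (_ + _)%N.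
  by apply: eq_bigr => e _; rewrite mulnb andbb.
rewrite deg_sum [RHS](bigD1 u) //= adj_irr add0n.
by apply: eq_bigr => w wu; rewrite sum_edges_two // eq_sym.
Qed.

(** Two edges sharing two vertices coincide, so distinct edges meet in at most one vertex. *)
Lemma sum_common_vertices (e f : edge G) :
  (\sum_u (u \in val e) * (u \in val f) =
   if e == f then 2 else (val e :&: val f != set0) : nat)%N.
Proof.
transitivity #|val e :&: val f|.
  rewrite -sum1_card [RHS]big_mkcond.
  by apply: eq_bigr => u _; rewrite inE mulnb; case: (_ && _).
case: eqVneq => [->|ef]; first by rewrite setIid card_edge.
rewrite -card_gt0.
suff : (#|val e :&: val f| < 2)%N by case: #|_| => [|[]].
rewrite ltnNge; apply: contra ef => ef2; apply/eqP/val_inj.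
have eE : val e :&: val f = val e.
  by apply/eqP; rewrite eqEcard subsetIl card_edge.
have fE : val e :&: val f = val f.
  by apply/eqP; rewrite eqEcard subsetIr card_edge.
by rewrite -eE.
Qed.

(** Each end of [e] lies on [t] edges, which gives 2t incidences; [e] itself accounts for 2 of
    them. *)
Lemma sum_adjacent_edges (t : nat) (e : edge G) : regular G t ->
  (2 + \sum_(f : edge G) ((e != f) && (val e :&: val f != set0)) = t.*2)%N.
Proof.
move=> reg; transitivity (\sum_(f : edge G) \sum_u (u \in val e) * (u \in val f))%N.
  rewrite (bigD1 e) //= eqxx add0n [RHS](bigD1 e) //= sum_common_vertices eqxx.
  congr addn; apply: eq_bigr => f fe.
  by rewrite sum_common_vertices eq_sym (negPf fe).
rewrite exchange_big /=; under eq_bigr do rewrite -big_distrr /= sum_edges_at reg.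
by rewrite -big_distrl /= sum_mem_edge mul2n.
Qed.

End Incidence.

(** * Degrees in the join *)

Section JoinDegrees.
Variables (G1 G2 : sgraph) (t : nat).
Hypothesis reg : regular G1 t.

Lemma deg_join_old (u : G1) : deg (inl (inl u) : T_edge_join G1 G2) = t.*2.
Proof.
rewrite deg_sum !big_sumType /= -deg_sum reg sum_edges_at reg.
by rewrite big1 // addn0 addnn.
Qed.

Lemma deg_join_new (e : edge G1) :
  deg (inl (inr e) : T_edge_join G1 G2) = (t.*2 + #|G2|)%N.
Proof.
rewrite deg_sum !big_sumType /= sum_mem_edge (sum_adjacent_edges _ reg).
by rewrite sum1_card.
Qed.

Lemma deg_join_right (w : G2) :
  deg (inr w : T_edge_join G1 G2) = (gsize G1 + deg w)%N.
Proof.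
rewrite deg_sum !big_sumType /= -deg_sum big1 // add0n sum1_card.
by rewrite card_sig.
Qed.

End JoinDegrees.

(** * Block form of the matrix of the join *)

Lemma sum_enum_val (T : finType) (F : T -> nat) :
  (\sum_(i < #|T|) F (enum_val i) = \sum_x F x)%N.
Proof. by rewrite -(big_enum_val F). Qed.

Section BlockForm.
(** The computation takes place over any field [K] receiving [R]; finally [K] is the field of
    rational functions and [f] the embedding of constants. *)
Variables (R : realType) (K : fieldType) (f : {rmorphism R -> K}).

(** Entries are indexed by vertices rather than ordinals, which makes them independent of the
    enumeration. *)
Definition alpha_entry (alpha : R) (G : sgraph) (u v : G) : R :=
  alpha * (deg u)%:R *+ (u == v) + (1 - alpha) * (adj u v)%:R.

Lemma A_alphaE alpha (G : sgraph) :
  A_alpha alpha G = \matrix_(i, j) alpha_entry alpha (enum_val i) (enum_val j : G).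
Proof.
apply/matrixP=> i j; rewrite !mxE /alpha_entry (inj_eq enum_val_inj).
by congr (_ + _); exact: mulrnAr.
Qed.

Definition inc_mx (G : sgraph) : 'M[K]_(gorder G, #|edge G|) :=
  \matrix_(i, e) ((enum_val i : G) \in val (enum_val e : edge G))%:R.

Lemma inc_mul_tr (G : sgraph) (t : nat) : regular G t ->
  inc_mx G *m (inc_mx G)^T = map_mx f (adj_mx R G) + t%:R%:M.
Proof.
move=> reg; apply/matrixP=> i j; rewrite !mxE.
under eq_bigr do rewrite !mxE -natrM.
rewrite -natr_sum rmorph_nat.
rewrite (sum_enum_val
  (fun e : edge G => (enum_val i \in val e) * (enum_val j \in val e))%N) /=.
have [->|ij] := eqVneq i j.
  rewrite adj_irr add0r mulr1n; congr _%:R.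
  rewrite -[RHS](reg (enum_val j)) -sum_edges_at.
  by apply: eq_bigr => e _; rewrite mulnb andbb.
by rewrite mulr0n addr0 sum_edges_two // (inj_eq enum_val_inj).
Qed.

Lemma tr_inc_mul (G : sgraph) (e g : 'I_#|edge G|) :
  ((inc_mx G)^T *m inc_mx G) e g =
  2%:R *+ (e == g) +
  ((enum_val e != enum_val g) &&
    (val (enum_val e : edge G) :&: val (enum_val g : edge G) != set0))%:R.
Proof.
rewrite !mxE; under eq_bigr do rewrite !mxE -natrM.
rewrite -natr_sum.
rewrite (sum_enum_val
  (fun u : G => (u \in val (enum_val e)) * (u \in val (enum_val g)))%N) /=.
rewrite sum_common_vertices (inj_eq enum_val_inj).
by case: eqVneq => _; rewrite ?addr0 ?mulr0n ?add0r.
Qed.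

Lemma tr_inc_ones (G : sgraph) :
  (inc_mx G)^T *m (const_mx 1 : 'cV_(gorder G)) = const_mx 2.
Proof.
apply/matrixP=> e j; rewrite !mxE; under eq_bigr do rewrite !mxE mulr1.
rewrite -natr_sum.
rewrite (sum_enum_val (fun u : G => u \in val (enum_val e) : nat)) /=.
by rewrite sum_mem_edge.
Qed.

Lemma adj_mx_sym (G : sgraph) : (adj_mx R G)^T = adj_mx R G.
Proof. by apply/matrixP=> i j; rewrite !mxE adj_sym. Qed.

Lemma adj_mx_row_sum (G : sgraph) (t : nat) i : regular G t ->
  \sum_j adj_mx R G i j = t%:R.
Proof.
move=> reg; under eq_bigr do rewrite mxE; rewrite -natr_sum.
rewrite (sum_enum_val (fun v : G => adj (enum_val i) v : nat)) /=.
by rewrite -deg_sum reg.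
Qed.

Lemma A_alpha_sym (alpha : R) (G : sgraph) : (A_alpha alpha G)^T = A_alpha alpha G.
Proof.
rewrite /A_alpha linearD !linearZ /= adj_mx_sym.
by rewrite /deg_mx tr_diag_mx.
Qed.

Lemma A_alpha_regular (alpha : R) (G : sgraph) (t : nat) : regular G t ->
  A_alpha alpha G = (alpha * t%:R)%:M + (1 - alpha) *: adj_mx R G.
Proof.
move=> reg; rewrite /A_alpha; congr (_ + _).
by apply/matrixP=> i j; rewrite !mxE reg; exact: mulrnAr.
Qed.

Lemma det_A_alpha_join (alpha : R) (G1 G2 : sgraph) (t : nat) (x : K) :
  regular G1 t ->
  let a := f alpha in let c := 1 - a in let B := inc_mx G1 in
  \det (x%:M - map_mx f (A_alpha alpha (T_edge_join G1 G2))) =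
  \det (block_mx
    (block_mx ((x - 2 * a * t%:R)%:M - c *: map_mx f (adj_mx R G1))
              (- (c *: B)) (- (c *: B^T))
              ((x + 2 - 2 * a - 2 * a * t%:R - a * (gorder G2)%:R)%:M
               - c *: (B^T *m B)))
    (col_mx 0 (- (c *: const_mx 1))) (row_mx 0 (- (c *: const_mx 1)))
    ((x - a * (gsize G1)%:R)%:M - map_mx f (A_alpha alpha G2))).
Proof.
move=> reg a c B.
pose e (u v : T_edge_join G1 G2) := x *+ (u == v) - f (alpha_entry alpha u v).
pose h := sum_index
  (sum_index (@enum_val G1 (mem G1)) (@enum_val (edge G1) (mem (edge G1))))
  (@enum_val G2 (mem G2)).
have hI : injective h by do 2?apply: sum_index_inj; exact: enum_val_inj.
have -> : x%:M - map_mx f (A_alpha alpha (T_edge_join G1 G2)) =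
    \matrix_(i, j) e (enum_val i) (enum_val j).
  by rewrite A_alphaE; apply/matrixP=> i j; rewrite !mxE /e (inj_eq enum_val_inj).
rewrite (det_reindex e hI); last by rewrite !card_sum.
rewrite (@matrix_sum_index _ _ _ (total_graph G1) G2).
rewrite (@matrix_sum_index _ _ _ G1 (edge G1) _ _ (fun u v => e (inl u) (inl v))).
have fB : f (1 - alpha) = c by rewrite rmorphB rmorph1.
(* Seven blocks follow: four inside T(G1), the two linking it to G2, and that of G2. *)
congr (\det (block_mx (block_mx _ _ _ _) _ _ _)); apply/matrixP=> i j.
- rewrite !mxE /e /alpha_entry !(inj_eq inl_inj) (inj_eq enum_val_inj).
  rewrite (deg_join_old _ reg) -muln2 /c /a.
  by case: eqVneq => _; rewrite ?mulr1n ?mulr0n; ring.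
- rewrite !mxE /e /alpha_entry /= mulr0n sub0r; congr (- _).
  by rewrite mulr0n add0r rmorphM rmorph_nat fB.
- rewrite !mxE /e /alpha_entry /= mulr0n sub0r; congr (- _).
  by rewrite mulr0n add0r rmorphM rmorph_nat fB.
(* The diagonal 2 of [B^T *m B] is compensated by the summand 2 - 2a of the scalar part. *)
- move: (tr_inc_mul i j); rewrite -/B; move: (B^T *m B) => Z ZE.
  rewrite !mxE ZE /e /alpha_entry !(inj_eq inl_inj) (inj_eq inr_inj) (inj_eq enum_val_inj).
  rewrite (deg_join_new _ reg) -muln2 natrD natrM /c /a /=.
  case: (eqVneq i j) => [->|ij].
    by rewrite eqxx /= !mulr1n; ring.
  by rewrite !mulr0n (inj_eq enum_val_inj) ij; ring.
- rewrite mxE /sum_index -{2}(splitK i).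
  case: (split i) => k /=; rewrite ?col_mxEu ?col_mxEd !mxE /e /alpha_entry /=.
    by rewrite mulr0n sub0r mulr0n add0r mulr0 rmorph0 oppr0.
  by rewrite mulr0n sub0r mulr0n add0r mulr1n !mulr1 fB.
- rewrite mxE /sum_index -{2}(splitK j).
  case: (split j) => k /=; rewrite ?row_mxEl ?row_mxEr !mxE /e /alpha_entry /=.
    by rewrite mulr0n sub0r mulr0n add0r mulr0 rmorph0 oppr0.
  by rewrite mulr0n sub0r mulr0n add0r mulr1n !mulr1 fB.
- rewrite A_alphaE !mxE /e /alpha_entry.
  rewrite !(inj_eq inr_inj) (inj_eq enum_val_inj) deg_join_right natrD /c /a /=.
  by case: (eqVneq i j) => _; rewrite ?mulr1n ?mulr0n; ring.
Qed.

End BlockForm.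

(** * Factorization of the determinant of the join *)

Section JoinDeterminant.
Variables (R : realType) (K : fieldType) (f : {rmorphism R -> K}).
Variables (alpha : R) (G1 G2 : sgraph) (t1 : nat) (x : K).
Hypothesis alpha01 : 0 <= alpha <= 1.
Hypothesis n1_gt0 : (0 < gorder G1)%N.
Hypothesis reg : regular G1 t1.

Let a : K := f alpha.
Let t : K := t1%:R.
Let n : K := (gorder G2)%:R.
Let y : K := x + 2 - 2 * a - 2 * a * t - a * n.
Let N : 'M[K]_(gorder G2) :=
  (x - a * (gsize G1)%:R)%:M - map_mx f (A_alpha alpha G2).
Let coronalN : K := ((const_mx 1 : 'cV_(gorder G2))^T *m invmx N
                     *m (const_mx 1 : 'cV_(gorder G2))) 0 0.
Let lam i : K := f (lambda (A_alpha alpha G1) i).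

Lemma lambda1_regular : lambda (A_alpha alpha G1) 1 = t1%:R.
Proof.
have /andP[a0 a1] := alpha01.
apply: lambda1_row_sum => //; first exact: A_alpha_sym.
  (* The bounds on [alpha] make the entries nonnegative, as Gershgorin requires. *)
  move=> i j; rewrite !mxE addr_ge0 ?mulr_ge0 ?subr_ge0 ?ler0n //.
  by rewrite mulrn_wge0.
move=> j; rewrite -[A_alpha _ _]A_alpha_sym (A_alpha_regular _ reg).
have := adj_mx_row_sum R j reg; move: (adj_mx R G1) => Z Zj.
under eq_bigr do rewrite !mxE.
rewrite big_split /= -mulr_sumr Zj.
rewrite (bigD1 j) //= big1 ?addr0 => [|i ij].
  by rewrite eqxx mulr1n; ring.
by rewrite eq_sym (negPf ij).
Qed.

Lemma prod_eigenvalues (S P : 'M[R]_(gorder G1)) d (Q : R -> K) :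
  P \in unitmx -> S = invmx P *m diag_mx d *m P -> S^T = S ->
  \prod_i Q (d 0 i) = Q (lambda S 1) * \prod_(2 <= i < (gorder G1).+1) Q (lambda S i).
Proof.
move=> uP SE symS.
have -> : \prod_i Q (d 0 i) = \prod_(v <- eigenvalues S) Q v.
  by rewrite (perm_big _ (perm_eigenvalues uP SE)) /= big_map big_enum.
(* List positions start at 0 and [lambda] at 1, hence the shift; positive order lets the first
   factor split off. *)
by rewrite (big_nth 0) size_eigenvalues // big_ltn // [in RHS]big_add1.
Qed.

(** These nonvanishing conditions all hold when [x] is the indeterminate [nu]. *)
Hypothesis two0 : (2 : K) != 0.
Hypothesis y0 : y != 0.
Hypothesis uN : N \in unitmx.
Hypothesis uP :
  (x - 2 * a * t)%:M - (1 - a) *: map_mx f (adj_mx R G1) \in unitmx.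
Hypothesis q0 : (x - t - a * t) * (x + 2 - 2 * a - 2 * t - a * n)
                - 2 * t * (1 - a) ^+ 2 != 0.

(** G2 is linked to the edge vertices only, by all-ones blocks, so the correction stays in the edge
    block and the product around [invmx N] collapses to the coronal. *)
Lemma join_schur_complement :
  \det (x%:M - map_mx f (A_alpha alpha (T_edge_join G1 G2))) =
  \det N * \det (block_mx
    ((x - 2 * a * t)%:M - (1 - a) *: map_mx f (adj_mx R G1))
    (- ((1 - a) *: inc_mx K G1)) (- ((1 - a) *: (inc_mx K G1)^T))
    (y%:M - (1 - a) *: ((inc_mx K G1)^T *m inc_mx K G1)
     - ((1 - a) ^+ 2 * coronalN) *: const_mx 1)).
Proof.
rewrite (det_A_alpha_join _ _ _ _ reg) det_schur_dr //; congr (_ * \det _).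
rewrite mul_col_mx mul0mx mul_col_row mul0mx.
rewrite opp_block_mx add_block_mx mul0mx mulmx0 !subr0.
congr (block_mx _ _ _ (_ - _)).
rewrite !mulNmx mulmxN opprK -!scalemxAl -scalemxAr scalerA -expr2 -scalerA.
congr (_ *: _).
have onesE p q : const_mx 1 = (const_mx 1 : 'cV[K]_p) *m (const_mx 1 : 'rV_q).
  by rewrite mul_const1_mx mulr1.
have -> : const_mx 1 *m invmx N *m const_mx 1 =
    (const_mx 1 : 'cV_#|edge G1|)
    *m ((const_mx 1 : 'rV_(gorder G2)) *m invmx N *m (const_mx 1 : 'cV_(gorder G2)))
    *m (const_mx 1 : 'rV_#|edge G1|).
  by rewrite (onesE _ (gorder G2)) (onesE (gorder G2)) !mulmxA.
have -> : (const_mx 1 : 'rV_(gorder G2)) *m invmx N *m (const_mx 1 : 'cV_(gorder G2))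
    = coronalN%:M.
  by rewrite [LHS]mx11_scalar /coronalN trmx_const.
by rewrite mul_mx_scalar -scalemxAl -onesE.
Qed.

Lemma det_A_alpha_join_factored :
  \det (x%:M - map_mx f (A_alpha alpha (T_edge_join G1 G2))) =
  y ^ ((gsize G1)%:Z - (gorder G1)%:Z) * \det N
  * (\prod_(2 <= i < (gorder G1).+1)
      (x ^+ 2 + (2 - t - 2 * a - a * t - a * n - 2 * lam i) * x
       - t * (1 - a) * (1 - 3 * a)
       + (a * t + lam i) * (t - 3 + 3 * a + a * n + lam i)))
  * ((x - t - a * t) * (x + 2 - 2 * a - 2 * t - a * n)
     - 2 * t * (1 - a) ^+ 2
     - 1 / 2 * t * (gorder G1)%:R * (1 - a) ^+ 2 * (x - t - a * t) * coronalN).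
Proof.
rewrite join_schur_complement.
set A := map_mx f (adj_mx R G1).
set S := A_alpha alpha G1.
have rowA : A *m (const_mx 1 : 'cV_(gorder G1)) = t *: const_mx 1.
  apply/matrixP=> i j; rewrite !mxE; under eq_bigr do rewrite !mxE mulr1.
  have := congr1 f (adj_mx_row_sum R i reg).
  rewrite rmorph_sum rmorph_nat mulr1 -/t => <-.
  by apply: eq_bigr => k _; rewrite mxE.
have symA : A^T = A by rewrite map_trmx adj_mx_sym.
rewrite (det_total_blocks _ y0 two0 uP (inc_mul_tr f reg) rowA symA (tr_inc_ones K G1)).
have -> : #|edge G1| = gsize G1 by rewrite card_sig.
rewrite mulrCA -[RHS]mulrA -[RHS]mulrA; congr (_ * (_ * _)).
set c := 1 - a; set h := (_ / 2 * _ * t).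
pose C := c *: A.
(* [b] and [k] are read off by expanding the matrix as a monic quadratic in [C]. *)
pose b := c * t - y - (x - 2 * a * t) - c.
pose k := (x - 2 * a * t) * y - (x - 2 * a * t + c) * (c * t).
have -> : y *: ((x - 2 * a * t)%:M - c *: A)
   - ((x - 2 * a * t)%:M - c *: A + c%:M) *m (c *: A + (c * t)%:M)
   - h *: const_mx 1 = C *m C + b *: C + k%:M - h *: const_mx 1.
  congr (_ - _); rewrite -/C.
  rewrite !mulmxDl !mulmxDr !mulNmx !mul_scalar_mx !mul_mx_scalar.
  apply/matrixP=> i j; rewrite !mxE; move: (\sum_(_ < _) _) => s.
  by rewrite /b /k; case: (i == j); rewrite ?mulr1n ?mulr0n; ring.
have [P [d [uP0 SE]]] := symmetric_diagonalizable (A_alpha_sym alpha G1).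
(* By regularity [C] is A_alpha(G1) minus the scalar a t, so the same [P] diagonalizes it with
   shifted eigenvalues. *)
have CE : C = invmx (map_mx f P) *m diag_mx (\row_i (f (d 0 i) - a * t)) *m map_mx f P.
  have -> : diag_mx (\row_i (f (d 0 i) - a * t)) = map_mx f (diag_mx d) - (a * t)%:M.
    apply/matrixP=> i j; rewrite !mxE rmorphMn /=.
    by case: (i == j); rewrite ?mulr1n ?mulr0n ?subr0.
  rewrite mulmxBr mulmxBl mul_mx_scalar -scalemxAl mulVmx ?map_unitmx //.
  rewrite -map_invmx -!map_mxM -SE (A_alpha_regular _ reg) map_mxD map_scalar_mx.
  rewrite map_mxZ scalemx1 rmorphM rmorph_nat rmorphB rmorph1.
  by rewrite addrAC subrr add0r.
have C1 : C *m const_mx 1 = (c * t) *: (const_mx 1 : 'M_(gorder G1)).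
  have -> : const_mx 1 = (const_mx 1 : 'cV[K]_(gorder G1)) *m (const_mx 1 : 'rV_(gorder G1)).
    by rewrite mul_const1_mx mulr1.
  by rewrite mulmxA -scalemxAl rowA scalerA -scalemxAl.
have qE : (c * t) ^+ 2 + b * (c * t) + k =
    (x - t - a * t) * (x + 2 - 2 * a - 2 * t - a * n) - 2 * t * c ^+ 2.
  by rewrite /b /k /y /c; ring.
have uPf : map_mx f P \in unitmx by rewrite map_unitmx.
rewrite (det_quadratic_sub_ones _ uPf CE C1) ?qE //.
under eq_bigr do rewrite mxE.
rewrite (@prod_eigenvalues S P d (fun v => (f v - a * t) ^+ 2 + b * (f v - a * t) + k)) //;
  last exact: A_alpha_sym.
rewrite lambda1_regular rmorph_nat -/t mulrAC mulrC; congr (_ * _).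
  apply: eq_bigr => i _; rewrite -/(lam i).
  by rewrite /b /k /y /c; ring.
(* The factor of lambda_1 is thus the quadratic at [c * t], which cancels the denominator of the
   all-ones correction. *)
have -> : t - a * t = c * t by rewrite /c; ring.
rewrite qE /h /c; field.
by rewrite two0.
Qed.

End JoinDeterminant.

(** * Nonvanishing in the field of rational functions *)

Section RationalFunctions.
Variable R : realType.

HB.instance Definition _ :=
  GRing.RMorphism.copy (@constF R) (@tofrac {poly R} \o polyC).

Lemma constF_eq0 (c : R) : (c%:K == 0) = (c == 0).
Proof. by rewrite /constF /polyF tofrac_eq0 polyC_eq0. Qed.

Lemma nu_sub_const_neq0 (c : R) : nu - c%:K != 0.
Proof. by rewrite /nu /constF /polyF -rmorphB tofrac_eq0 polyXsubC_eq0. Qed.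

(** A product of two monic linear polynomials has degree 2 and cannot equal a constant. *)
Lemma nu_quadratic_neq0 (u v w : R) : (nu - u%:K) * (nu - v%:K) - w%:K != 0.
Proof.
rewrite /nu /constF /polyF -!rmorphB -rmorphM -rmorphB tofrac_eq0 subr_eq0.
apply/eqP => /(congr1 (fun p : {poly R} => size p)).
rewrite size_mul ?polyXsubC_eq0 // !size_XsubC /= => E.
by have := size_polyC_leq1 w; rewrite -E.
Qed.

(** The determinant is the characteristic polynomial of [c%:M + M], which is monic. *)
Lemma nu_sub_mx_unit n (M : 'M[R]_n) (c : R) :
  (nu - c%:K)%:M - map_mx (@constF R) M \in unitmx.
Proof.
have -> : (nu - c%:K)%:M - map_mx (@constF R) M =
    nu%:M - map_mx (@constF R) (c%:M + M).
  by rewrite map_mxD map_scalar_mx raddfB /= opprD addrA.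
rewrite unitmxE unitfE -[\det _]/(phi (c%:M + M) nu) phi_char_poly.
by rewrite /polyF tofrac_eq0 monic_neq0 // char_poly_monic.
Qed.

End RationalFunctions.

(** * Specialization to the indeterminate *)

Theorem theorem6p1 (R : realType) (alpha : R) (G1 G2 : sgraph)
    (t1 n1 m1 n2 : nat)
    (halpha : 0 <= alpha <= 1)
    (hn1 : gorder G1 = n1) (hn1pos : (0 < n1)%N) (hm1 : gsize G1 = m1)
    (hreg : regular G1 t1) (hn2 : gorder G2 = n2) :
  let a : ratfun R := alpha%:K in
  let t : ratfun R := t1%:R in
  let n : ratfun R := n2%:R in
  let lam (i : nat) : ratfun R := (lambda (A_alpha alpha G1) i)%:K in
  phi (A_alpha alpha (T_edge_join G1 G2)) nu =
    (nu + 2 - 2 * a - 2 * a * t - a * n) ^ (m1%:Z - n1%:Z)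
    * phi (A_alpha alpha G2) (nu - a * m1%:R)
    * (\prod_(2 <= i < n1.+1)
         (nu ^+ 2 + (2 - t - 2 * a - a * t - a * n - 2 * lam i) * nu
          - t * (1 - a) * (1 - 3 * a)
          + (a * t + lam i) * (t - 3 + 3 * a + a * n + lam i)))
    * ((nu - t - a * t) * (nu + 2 - 2 * a - 2 * t - a * n)
       - 2 * t * (1 - a) ^+ 2
       - 1 / 2 * t * n1%:R * (1 - a) ^+ 2 * (nu - t - a * t)
         * coronal (A_alpha alpha G2) (nu - a * m1%:R)).
Proof.
move=> a t n lam; subst n1 m1 n2.
have nat_K k : (k%:R : ratfun R) = k%:R%:K by rewrite rmorph_nat.
have a1 : 1 - a = (1 - alpha)%:K by rewrite rmorphB rmorph1.
(* The five goals left are the nonvanishing conditions; each is settled by writing its constants as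
   images of [constF]. *)
apply: (@det_A_alpha_join_factored _ _ (@constF R)) => //.
- by rewrite nat_K constF_eq0 pnatr_eq0.
- have := nu_sub_const_neq0
    (- (2 - 2 * alpha - 2 * alpha * t1%:R - alpha * (gorder G2)%:R)).
  by congr (_ != 0); ring.
- by rewrite nat_K -rmorphM; exact: nu_sub_mx_unit.
- rewrite -/a a1 -map_mxZ.
  have -> : nu - 2 * a * t1%:R = nu - (2 * alpha * t1%:R)%:K by ring.
  exact: nu_sub_mx_unit.
- have := nu_quadratic_neq0 (t1%:R + alpha * t1%:R)
    (- (2 - 2 * alpha - 2 * t1%:R - alpha * (gorder G2)%:R))
    (2 * t1%:R * (1 - alpha) ^+ 2).
  by congr (_ != 0); ring.
Qed.
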